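(* Let $\boldsymbol{A}\in\mathbb{R}^{n\times n}$ and let $\boldsymbol{A}^{g}$ be a generalized inverse of $\boldsymbol{A}$. Then, for every $\alpha\neq 0$, GMRES with right preconditioning operator $\alpha\boldsymbol{A}^{g}$ converges to a least-squares solution of $\boldsymbol{A}\boldsymbol{x}\approx\boldsymbol{b}$ after one iteration for all $\boldsymbol{b}\in\mathcal{R}(\boldsymbol{A})$ and all $\boldsymbol{x}_{0}\in\mathbb{R}^{n}$. Conversely, if $\boldsymbol{G}\in\mathbb{R}^{n\times n}$ is such that GMRES with right preconditioning operator $\boldsymbol{G}$ converges to a least-squares solution of $\boldsymbol{A}\boldsymbol{x}\approx\boldsymbol{b}$ in one iteration for all $\boldsymbol{b}\in\mathcal{R}(\boldsymbol{A})$ and all $\boldsymbol{x}_{0}\in\mathbb{R}^{n}$, then $\boldsymbol{G}$ is a scalar multiple of a generalized inverse of $\boldsymbol{A}$.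
   Context: $\mathcal{R}(\cdot)$ denotes the range (column space). Exact arithmetic is assumed. A matrix $\boldsymbol{A}^{g}$ is a generalized inverse of $\boldsymbol{A}$ if $\boldsymbol{A}\boldsymbol{A}^{g}\boldsymbol{A}=\boldsymbol{A}$. A least-squares (LS) solution of $\boldsymbol{A}\boldsymbol{x}\approx\boldsymbol{b}$ is a minimizer of $\Vert\boldsymbol{b}-\boldsymbol{A}\boldsymbol{x}\Vert_{2}$ over $\boldsymbol{x}\in\mathbb{R}^n$. Krylov subspaces: $\mathcal{K}_{k}(\boldsymbol{B},\boldsymbol{v})=\mathrm{span}\{\boldsymbol{v},\boldsymbol{B}\boldsymbol{v},\dots,\boldsymbol{B}^{k-1}\boldsymbol{v}\}$, $\mathcal{K}_0=\{\boldsymbol 0\}$. GMRES with right preconditioning operator (RPO) $\boldsymbol{G}\in\mathbb{R}^{n\times n}$ and initial guess $\boldsymbol{x}_0$ sets $\boldsymbol{r}_0=\boldsymbol{b}-\boldsymbol{A}\boldsymbol{x}_0$ and at step $k$ produces $\boldsymbol{x}_k=\boldsymbol{x}_0+\boldsymbol{G}\boldsymbol{y}_k$, where $\boldsymbol{y}_k$ minimizes $\Vert\boldsymbol{r}_0-\boldsymbol{A}\boldsymbol{G}\boldsymbol{y}\Vert_2$ over $\boldsymbol{y}\in\mathcal{K}_k(\boldsymbol{A}\boldsymbol{G},\boldsymbol{r}_0)$. Converging to an LS solution after (in) one iteration means that $\boldsymbol{x}_1$ is an LS solution. *)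

(* Defs.v *)
From mathcomp Require Import all_boot all_order all_algebra.
From mathcomp Require Import reals.

Set Implicit Arguments.
Unset Strict Implicit.
Unset Printing Implicit Defensive.

Import Order.TTheory GRing.Theory Num.Theory.
Local Open Scope ring_scope.

(* Written out because the norm that MathComp-Analysis puts on matrices is the
   max norm. *)
Definition norm2 (R : realType) (n : nat) (v : 'cV[R]_n) : R :=
  Num.sqrt (\sum_(i < n) v i 0 ^+ 2).

Definition minimizer (R : realType) (T : Type) (f : T -> R) (P : T -> Prop)
    (x : T) : Prop :=
  P x /\ forall z, P z -> f x <= f z.

Definition in_range (R : realType) (m n : nat) (A : 'M[R]_(m, n))
    (b : 'cV[R]_m) : Prop :=
  exists x : 'cV[R]_n, b = A *m x.

Definition generalized_inverse (R : realType) (m n : nat) (A : 'M[R]_(m, n))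
    (Ag : 'M[R]_(n, m)) : Prop :=
  A *m Ag *m A = A.

Definition LS_solution (R : realType) (m n : nat) (A : 'M[R]_(m, n))
    (b : 'cV[R]_m) (x : 'cV[R]_n) : Prop :=
  minimizer (fun z => norm2 (b - A *m z)) (fun=> True) x.

Definition krylov (R : realType) (n : nat) (k : nat) (B : 'M[R]_n)
    (v : 'cV[R]_n) : {vspace 'cV[R]_n} :=
  <<[seq B ^+ i *m v | i <- iota 0 k]>>%VS.

(* A relation rather than a function: when A *m G is singular, the minimizer y
   over the Krylov subspace need not be unique. *)
Definition gmres_iterate (R : realType) (n : nat) (A G : 'M[R]_n)
    (b x0 : 'cV[R]_n) (k : nat) (xk : 'cV[R]_n) : Prop :=
  let r0 := b - A *m x0 in
  exists y : 'cV[R]_n,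
    minimizer (fun z => norm2 (r0 - A *m G *m z))
              (fun z => z \in krylov k (A *m G) r0) y
    /\ xk = x0 + G *m y.

(* The iterate x_k exists, and it is a least-squares solution whichever
   minimizer y is selected. *)
Definition gmres_converges_in (R : realType) (n : nat) (A G : 'M[R]_n)
    (b x0 : 'cV[R]_n) (k : nat) : Prop :=
  (exists xk, gmres_iterate A G b x0 k xk) /\
  (forall xk, gmres_iterate A G b x0 k xk -> LS_solution A b xk).

(* Main.v *)
Require Import Defs.
From mathcomp Require Import all_boot all_order all_algebra.
From mathcomp Require Import reals.

(** The least-squares solutions of a consistent system are its exact solutions,
    and the first Krylov space is the line spanned by [r0], which lies in the
    range of [A] when [b] does.  Hence the first GMRES step
    ends at a least-squares solution exactly when [r0 = c *: (A *m G *m r0)] for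
    some scalar [c].

    If [G = alpha *: Ag], then [A *m G] acts on the range of [A] as the
    homothety of ratio [alpha], so [c = alpha^-1] makes the residual vanish and
    every minimizer does as well.

    Conversely, taking [x0 = 0] and [b = A *m z] gives, for each [z], a scalar
    [c], a priori depending on [z], with [A *m z = c *: (A *m G *m A *m z)].
    Lemma [pointwise_scale_mx] shows that one [c] serves all [z], that is
    [A = c *: (A *m G *m A)].  Hence [c *: G] is a generalized inverse of [A]
    and, when [c] is nonzero, [G] is a multiple of it; when [c = 0], the matrix
    [A] vanishes and every matrix is a generalized inverse of it. *)

Set Implicit Arguments.
Unset Strict Implicit.
Unset Printing Implicit Defensive.

Import Order.TTheory GRing.Theory Num.Theory.
Local Open Scope ring_scope.

Lemma eq_mx_mul_cV (F : fieldType) (m n : nat) (P Q : 'M[F]_(m, n)) :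
  (forall z : 'cV[F]_n, P *m z = Q *m z) -> P = Q.
Proof.
move=> PQ; apply/matrixP=> i j.
by have /matrixP/(_ i 0) := PQ (delta_mx j 0); rewrite -!colE !mxE.
Qed.

(** This extends the fact that a matrix for which every vector is an
    eigenvector is scalar.  Fix [z0] outside the kernel of [Q], with ratio [c].
    If [Q *m z] is a multiple of [Q *m z0], then [z] differs from a multiple of
    [z0] by an element of the kernel of [Q], on which [P] vanishes too, so [z]
    has ratio [c].  Otherwise [Q *m z] and [Q *m z0] are independent, and the
    hypothesis at [z + z0] forces the ratios at [z] and [z0] to agree. *)
Lemma pointwise_scale_mx (F : fieldType) (m n : nat) (P Q : 'M[F]_(m, n)) :
  (forall z : 'cV[F]_n, exists c, P *m z = c *: (Q *m z)) ->
  exists c, P = c *: Q.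
Proof.
move=> PQ; have [Q0|] := eqVneq Q 0.
  exists 0; apply: eq_mx_mul_cV => z; have [c ->] := PQ z.
  by rewrite Q0 scaler0 !mul0mx scaler0.
case/matrix0Pn=> i [j Qij].
pose z0 : 'cV[F]_n := delta_mx j 0.
have Qz0 : Q *m z0 != 0.
  by apply/matrix0Pn; exists i, 0; rewrite -colE mxE.
have [c Pz0] := PQ z0.
exists c; apply: eq_mx_mul_cV => z; rewrite -scalemxAl.
have dep t : Q *m z = t *: (Q *m z0) -> P *m z = c *: (Q *m z).
  move=> Qz; have [d] := PQ (z - t *: z0).
  rewrite !mulmxBr -!scalemxAr Qz subrr scaler0 Pz0 => /eqP.
  by rewrite subr_eq0 => /eqP->; rewrite !scalerA mulrC.
have [e Pz] := PQ z; have [d] := PQ (z + z0).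
rewrite !mulmxDr Pz Pz0 scalerDr => Pzz0.
have rel : (e - d) *: (Q *m z) = (d - c) *: (Q *m z0).
  rewrite !scalerBl; apply/eqP.
  by rewrite subr_eq addrAC eq_sym subr_eq Pzz0 addrC.
have [ed|ed] := eqVneq e d; last first.
  rewrite -Pz; apply: (dep ((e - d)^-1 * (d - c))).
  by rewrite -scalerA -rel scalerA mulVf ?scale1r // subr_eq0.
move: rel; rewrite ed subrr scale0r => /esym/eqP.
by rewrite scaler_eq0 (negPf Qz0) orbF subr_eq0 => /eqP->.
Qed.

Lemma norm2_ge0 (R : realType) (n : nat) (v : 'cV[R]_n) : 0 <= norm2 v.
Proof. exact: sqrtr_ge0. Qed.

Lemma norm2_eq0 (R : realType) (n : nat) (v : 'cV[R]_n) :
  norm2 v = 0 <-> v = 0.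
Proof.
split=> [/eqP|->]; last first.
  by rewrite /norm2 big1 ?sqrtr0 // => i _; rewrite mxE expr0n.
rewrite sqrtr_eq0 => sum_le0.
have sum0 : \sum_(i < n) v i 0 ^+ 2 = 0.
  by apply/eqP; rewrite eq_le sum_le0 sumr_ge0 // => i _; apply: sqr_ge0.
apply/colP=> i; rewrite mxE; apply/eqP; rewrite -sqrf_eq0; apply/eqP.
by apply: (psumr_eq0P _ sum0) => // k _; apply: sqr_ge0.
Qed.

(** Minimizing a norm over a set on which it reaches zero amounts to solving an
    equation; this covers both the least-squares problem of a consistent
    system and the residual minimization of a GMRES step that can end exactly. *)
Lemma minimizer_norm2_eq0 (R : realType) (T : Type) (n : nat)
    (f : T -> 'cV[R]_n) (P : T -> Prop) (x0 : T) :
  P x0 -> f x0 = 0 ->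
  forall x, minimizer (fun z => norm2 (f z)) P x <-> P x /\ f x = 0.
Proof.
move=> Px0 /norm2_eq0 fx0 x; split=> [[Px fmin]|[Px /norm2_eq0 fx]].
  split=> //; apply/norm2_eq0/eqP.
  by rewrite eq_le norm2_ge0 andbT -fx0 fmin.
by split=> // z _; rewrite fx norm2_ge0.
Qed.

Lemma LS_solution_consistent (R : realType) (m n : nat) (A : 'M[R]_(m, n))
    (b : 'cV[R]_m) (x : 'cV[R]_n) :
  in_range A b -> LS_solution A b x <-> A *m x = b.
Proof.
move=> [z bE]; have bz : b - A *m z = 0 by rewrite bE subrr.
split=> [/(minimizer_norm2_eq0 (x0 := z) I bz)[_ /eqP]|Ax].
  by rewrite subr_eq0 => /eqP.
by apply/(minimizer_norm2_eq0 (x0 := z) I bz); rewrite Ax subrr.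
Qed.

Lemma krylov1P (R : realType) (n : nat) (B : 'M[R]_n) (v y : 'cV[R]_n) :
  reflect (exists c, y = c *: v) (y \in krylov 1 B v).
Proof. by rewrite /krylov /= expr0 mul1mx span_seq1; apply: vlineP. Qed.

(** The hypothesis says that [c *: r0], a point of the first Krylov space,
    annihilates the new residual.  Hence so does every other minimizer [y] over
    that space, even where [A *m G] is singular, and [x0 + G *m y] solves the
    system exactly. *)
Lemma gmres_converges_in1 (R : realType) (n : nat) (A G : 'M[R]_n)
    (b x0 : 'cV[R]_n) (c : R) :
  in_range A b -> b - A *m x0 = c *: (A *m G *m (b - A *m x0)) ->
  gmres_converges_in A G b x0 1.
Proof.
move=> Ab; rewrite /gmres_converges_in /gmres_iterate /=.
set r0 := b - A *m x0 => r0E.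
have cr0 : c *: r0 \in krylov 1 (A *m G) r0 by apply/krylov1P; exists c.
have res0 : r0 - A *m G *m (c *: r0) = 0 by rewrite -scalemxAr -r0E subrr.
have minE := minimizer_norm2_eq0 (P := fun z => z \in krylov 1 (A *m G) r0)
  (f := fun z => r0 - A *m G *m z) cr0 res0.
split; first by exists (x0 + G *m (c *: r0)), (c *: r0); split; first exact/minE.
move=> _ [y [/minE[_ /eqP res_y] ->]]; apply/(LS_solution_consistent _ Ab).
by move: res_y; rewrite subr_eq0 mulmxDr mulmxA => /eqP<-; rewrite addrC subrK.
Qed.

Lemma gmres_converges_in1_scale (R : realType) (n : nat) (A G : 'M[R]_n)
    (b x0 : 'cV[R]_n) :
  in_range A b -> gmres_converges_in A G b x0 1 ->
  exists c, b - A *m x0 = c *: (A *m G *m (b - A *m x0)).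
Proof.
move=> Ab [[x1 iter_x1] LS]; have /(LS_solution_consistent _ Ab) := LS _ iter_x1.
case: iter_x1 => y [[/krylov1P[c yE] _] ->] Ax1.
exists c; rewrite scalemxAr -yE -mulmxA.
by rewrite -{1}Ax1 mulmxDr addrC addrA addNr add0r.
Qed.

Theorem theorem3p6 (R : realType) (n : nat) (A : 'M[R]_n) :
  (forall Ag : 'M[R]_n, generalized_inverse A Ag ->
     forall alpha : R, alpha != 0 ->
     forall b x0 : 'cV[R]_n, in_range A b ->
       gmres_converges_in A (alpha *: Ag) b x0 1)
  /\
  (forall G : 'M[R]_n,
     (forall b x0 : 'cV[R]_n, in_range A b ->
        gmres_converges_in A G b x0 1) ->
     exists (c : R) (Ag : 'M[R]_n),
       generalized_inverse A Ag /\ G = c *: Ag).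
Proof.
split=> [Ag AgP alpha alpha0 b x0 Ab|G conv].
  apply: (gmres_converges_in1 (c := alpha^-1)) => //.
  case: Ab => z ->; rewrite -mulmxBr -scalemxAr -scalemxAl scalerA mulVf //.
  by rewrite scale1r mulmxA AgP.
have [z|c AE] := @pointwise_scale_mx _ _ _ A (A *m G *m A).
  have Az : in_range A (A *m z) by exists z.
  have [c] := gmres_converges_in1_scale Az (conv _ 0 Az).
  by rewrite mulmx0 subr0 mulmxA => Ec; exists c.
have [c0|c0] := eqVneq c 0.
  exists 1, G; split; last by rewrite scale1r.
  by rewrite /generalized_inverse AE c0 scale0r mulmx0.
exists c^-1, (c *: G); split; last by rewrite scalerA mulVf ?scale1r.
by rewrite /generalized_inverse -scalemxAr -scalemxAl -AE.
Qed.
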